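(* There is no higher self-PA oracle. That is, for every $A\in 2^\omega$ there is a nonempty higher $A$-co-c.e. closed set $\mathcal{P}\subseteq 2^\omega$ which contains no higher $A$-computable point.
   Context: For $A\in 2^\omega$ and $W\subseteq 2^{<\omega}\times 2^{<\omega}$ let $W^A=\{\sigma : (\exists \tau\prec A)\ (\tau,\sigma)\in W\}$, where $\tau\prec A$ means that $\tau$ is a finite initial segment of $A$. For $V\subseteq 2^{<\omega}$ let $[V]^\prec=\{X\in 2^\omega : (\exists\sigma\prec X)\ \sigma\in V\}$. A subset of $2^\omega$ is higher $A$-c.e. open if it equals $[W^A]^\prec$ for some $\Pi^1_1$ (lightface, no oracle) set $W\subseteq 2^{<\omega}\times 2^{<\omega}$. A set is higher $A$-co-c.e. closed (also called higher $A$-effectively closed) if its complement in $2^\omega$ is higher $A$-c.e. open. A higher Turing functional is a $\Pi^1_1$ set $\Phi\subseteq 2^{<\omega}\times 2^{<\omega}$. For $X,Y\in 2^\omega$, $\Phi(X)=Y$ means that the strings $\sigma$ such that $(\tau,\sigma)\in\Phi$ for some $\tau\prec X$ are pairwise comparable and their union is $Y$. ($\Phi$ need not be consistent on oracles other than $X$.) $Y$ is higher $X$-computable, written $Y\leq_{\omega_1^{ck}T}X$, if $\Phi(X)=Y$ for some higher Turing functional $\Phi$. An oracle $A\in 2^\omega$ is higher self-PA if every nonempty higher $A$-co-c.e. closed set contains some higher $A$-computable point. *)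

(* Defs.v *)
From mathcomp Require Import all_boot.
From mathcomp Require Import boolp classical_sets.

Set Implicit Arguments.
Unset Strict Implicit.
Unset Printing Implicit Defensive.

Local Open Scope classical_set_scope.

Definition cantor := nat -> bool.
Definition bitstring := seq bool.

(* Arithmetical formulas of second-order arithmetic with a single free set
   variable X (and no set quantifier). Number variables are de Bruijn indices. *)
Inductive term : Type :=
  | Var of nat
  | Zero
  | Succ of term
  | Add of term & term
  | Mul of term & term.

Inductive arith_formula : Type :=
  | Eq of term & term
  | InX of term
  | Not of arith_formula
  | And of arith_formula & arith_formula
  | Forall of arith_formula.

(* The environment lists the values of the variables 0, 1, 2, ...; variables
   beyond its end denote 0, so they add no parameters. *)
Fixpoint eval (e : seq nat) (t : term) : nat :=
  match t with
  | Var i => nth 0 e i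
  | Zero => 0
  | Succ t => (eval e t).+1
  | Add t u => eval e t + eval e u
  | Mul t u => eval e t * eval e u
  end.

Fixpoint holds (X : cantor) (e : seq nat) (phi : arith_formula) : Prop :=
  match phi with
  | Eq t u => eval e t = eval e u
  | InX t => X (eval e t)
  | Not phi => ~ holds X e phi
  | And phi psi => holds X e phi /\ holds X e psi
  | Forall phi => forall n : nat, holds X (n :: e) phi
  end.

(* Bijective base-2 numeration, least significant digit first. *)
Fixpoint code (s : bitstring) : nat :=
  if s is b :: s' then (code s').*2 + b.+1 else 0.

(* W is the set of (tau, sigma) defined in the standard model by a
   parameter-free formula "forall X, phi(X, tau, sigma)", phi arithmetical. *)
Definition Pi11 (W : set (bitstring * bitstring)) : Prop :=
  exists phi : arith_formula, forall tau sigma : bitstring,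
    W (tau, sigma) <->
    forall X : cantor, holds X [:: code tau; code sigma] phi.

Definition initial_segment (tau : bitstring) (A : cantor) : Prop :=
  exists n : nat, tau = mkseq A n.

(* W^A *)
Definition section (W : set (bitstring * bitstring)) (A : cantor) :
    set bitstring :=
  [set sigma | exists2 tau, initial_segment tau A & W (tau, sigma)].

(* [V]^< *)
Definition cylinders (V : set bitstring) : set cantor :=
  [set X | exists2 sigma, initial_segment sigma X & V sigma].

Definition higher_ce_open (A : cantor) (U : set cantor) : Prop :=
  exists2 W, Pi11 W & U = cylinders (section W A).

Definition higher_coce_closed (A : cantor) (P : set cantor) : Prop :=
  higher_ce_open A (~` P).

Definition comparable (s t : bitstring) : bool := prefix s t || prefix t s.

(* Phi(X) = Y; the union of strings is taken as a union of finite partial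
   functions. *)
Definition functional_maps (Phi : set (bitstring * bitstring))
    (X Y : cantor) : Prop :=
  (forall s t, section Phi X s -> section Phi X t -> comparable s t) /\
  (forall (n : nat) (b : bool),
     (exists2 s, section Phi X s & onth s n = Some b) <-> Y n = b).

(* Y <= X in higher Turing reducibility: the oracle X comes first. *)
Definition higher_computable (X Y : cantor) : Prop :=
  exists2 Phi, Pi11 Phi & functional_maps Phi X Y.

Definition higher_self_PA (A : cantor) : Prop :=
  forall P : set cantor, higher_coce_closed A P -> P !=set0 ->
    exists2 Y, P Y & higher_computable A Y.

(* Main.v *)
Require Import Defs.
From mathcomp Require Import all_boot.
From mathcomp Require Import zify.
From mathcomp Require Import boolp classical_sets.

(** Fix a universal Pi^1_1 set of numbers (the well-founded part of one
    arithmetical relation) with its norm, the stage. The usual diagonal class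
    breaks down because a functional may enumerate both values on the oracle A,
    and no finite part of A tells which one came first. Suppose A is self-PA.
    - For a stage a, one can tell at finite cost whether a computation seen with
      use at most m is enumerated by stage a, so diagonalizing at <a, g> against
      the part of the g-th functional enumerated by stage a is harmless. A
      self-PA oracle computes a point Y of this class; if g is an index of Y,
      then Y(<a, g>) is not enumerated by stage a.
    - Hence "Y(m) is enumerated by stage a" is, for each m, an upward closed set
      of stages, nonempty, and not containing a if m = <a, g>. The supersets
      with the same properties form a closed class, so some family C of them is
      A-computable. It is a clock: stage a has elapsed by time m when it is not
      in C(m); at a given time the elapsed stages are bounded, as one sees from
      any element of C(m), and every stage elapses.
    - With this clock, "the value b, and no other, was enumerated by time m with
      use at most m" is A-enumerable. Forbidding such values gives a nonempty
      class without A-computable points, a contradiction. *)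

Set Implicit Arguments.
Unset Strict Implicit.
Unset Printing Implicit Defensive.

Local Open Scope classical_set_scope.

(** * Definability *)

(** A polynomial pairing, so that a pair of terms is again a term of the language. It is injective
    but not onto. *)
Definition npair (x y : nat) : nat := (x + y) * (x + y) + x.

Arguments npair : simpl never.

Lemma npair_inj x y x' y' : npair x y = npair x' y' -> x = x' /\ y = y'.
Proof.
rewrite /npair => H.
have [lt|gt|eq] := ltngtP (x + y) (x' + y').
- by exfalso; nia.
- by exfalso; nia.
- by rewrite eq in H; lia.
Qed.

(** This left inverse only serves to assemble sets from prescribed rows, so it may be chosen without
    being definable. *)
Lemma unpair_ex : exists p : nat -> nat * nat,
  forall x y, p (npair x y) = (x, y).
Proof.
exists (fun z => xget (0, 0) [set p | npair p.1 p.2 = z]) => x y.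
case: xgetP => [[x' y'] _ /= /npair_inj[-> ->] //|/(_ (x, y))].
by case.
Qed.

(** Definability is stated semantically, on functions and relations of the environment, so that
    tactics can follow the shape of a relation without anyone writing its formula. *)
Definition term_fun (f : seq nat -> nat) := exists t, forall e, eval e t = f e.

Definition arith (R : cantor -> seq nat -> Prop) :=
  exists phi, forall X e, holds X e phi <-> R X e.

Definition pi11 (R : seq nat -> Prop) :=
  exists phi, forall e, R e <-> forall X, holds X e phi.

Fixpoint subst_term (r : nat -> term) (t : term) : term :=
  match t with
  | Var i => r i
  | Zero => Zero
  | Succ t => Succ (subst_term r t)
  | Add t u => Add (subst_term r t) (subst_term r u)
  | Mul t u => Mul (subst_term r t) (subst_term r u)
  end.

Definition lift_term := subst_term (fun i => Var i.+1).

Definition lift_subst (r : nat -> term) (i : nat) : term :=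
  if i is i'.+1 then lift_term (r i') else Var 0.

Fixpoint subst (r : nat -> term) (phi : arith_formula) : arith_formula :=
  match phi with
  | Eq t u => Eq (subst_term r t) (subst_term r u)
  | InX t => InX (subst_term r t)
  | Not p => Not (subst r p)
  | And p q => And (subst r p) (subst r q)
  | Forall p => Forall (subst (lift_subst r) p)
  end.

Lemma eval_subst r e e' t : (forall i, eval e (r i) = nth 0 e' i) ->
  eval e (subst_term r t) = eval e' t.
Proof. by move=> H; elim: t => //= [t ->|t -> u ->|t -> u ->]. Qed.

Lemma eval_lift n e t : eval (n :: e) (lift_term t) = eval e t.
Proof. exact: eval_subst. Qed.

Lemma holds_subst X phi : forall r e e',
  (forall i, eval e (r i) = nth 0 e' i) ->
  holds X e (subst r phi) <-> holds X e' phi.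
Proof.
elim: phi => [t u|t|p IH|p IHp q IHq|p IH] r e e' H /=.
- by rewrite !(eval_subst _ H).
- by rewrite (eval_subst _ H).
- by rewrite (IH _ _ _ H).
- by rewrite (IHp _ _ _ H) (IHq _ _ _ H).
- have Hn n : holds X (n :: e) (subst (lift_subst r) p) <-> holds X (n :: e') p.
    by apply: IH => -[|i] //=; rewrite eval_lift.
  by split=> K n; apply/Hn.
Qed.

(* [row_formula u phi] speaks about the row [{m | npair u m \in X}] of X. *)
Fixpoint row_formula (u : term) (phi : arith_formula) : arith_formula :=
  match phi with
  | Eq t t' => Eq t t'
  | InX t => InX (Add (Mul (Add u t) (Add u t)) u)
  | Not p => Not (row_formula u p)
  | And p q => And (row_formula u p) (row_formula u q)
  | Forall p => Forall (row_formula (lift_term u) p)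
  end.

Lemma holds_row X phi : forall u e,
  holds X e (row_formula u phi) <->
  holds (fun m => X (npair (eval e u) m)) e phi.
Proof.
elim: phi => [t t'|t|p IH|p IHp q IHq|p IH] u e //=.
- by rewrite IH.
- by rewrite IHp IHq.
- by split=> H n; move: (H n); rewrite IH eval_lift.
Qed.

Lemma term_fun_nth i : term_fun (fun e => nth 0 e i).
Proof. by exists (Var i). Qed.

Lemma term_fun_head : term_fun (head 0).
Proof. by exists (Var 0) => -[]. Qed.

Lemma term_fun_behead f : term_fun f -> term_fun (fun e => f (behead e)).
Proof.
(* On the empty environment [behead] does nothing, and every variable denotes 0 before and after the
   shift. *)
case=> t Ht; exists (lift_term t) => -[|x e] /=; rewrite -Ht.
  by apply: eval_subst => i; rewrite /= nth_nil.
exact: eval_lift.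
Qed.

Lemma term_fun_iter_behead k f : term_fun f ->
  term_fun (fun e => f (iter k behead e)).
Proof.
move=> Hf; elim: k => [//|k]; rewrite /= => H.
have [t Ht] := term_fun_behead H; exists t => e; rewrite Ht.
by rewrite -iterSr.
Qed.

Lemma term_fun_const c : term_fun (fun=> c).
Proof.
by elim: c => [|c [t Ht]]; [exists Zero|exists (Succ t) => e /=; rewrite Ht].
Qed.

Lemma term_fun_succ f : term_fun f -> term_fun (fun e => (f e).+1).
Proof. by case=> t Ht; exists (Succ t) => e /=; rewrite Ht. Qed.

Lemma term_fun_add f g : term_fun f -> term_fun g ->
  term_fun (fun e => f e + g e).
Proof. by case=> t Ht [u Hu]; exists (Add t u) => e /=; rewrite Ht Hu. Qed.

Lemma term_fun_mul f g : term_fun f -> term_fun g ->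
  term_fun (fun e => f e * g e).
Proof. by case=> t Ht [u Hu]; exists (Mul t u) => e /=; rewrite Ht Hu. Qed.

Lemma term_fun_npair f g : term_fun f -> term_fun g ->
  term_fun (fun e => npair (f e) (g e)).
Proof.
by move=> Hf Hg; apply: term_fun_add => //; apply: term_fun_mul;
  apply: term_fun_add.
Qed.

(** Below some number of quantifiers, an outer variable is read behind as many applications of
    [behead]. That number is found by trying all values less than [k]. *)
Ltac solve_term_leaf H k := lazymatch k with
  | S ?k' => first [exact (term_fun_iter_behead k' H) | solve_term_leaf H k']
  end.

Ltac solve_term := cbv beta; lazymatch goal with
  | |- term_fun (fun _ => ?c) => exact (term_fun_const c)
  | |- term_fun (fun e => npair (@?f e) (@?g e)) =>
      apply (@term_fun_npair f g); solve_term
  | |- term_fun (fun e => S (@?f e)) => apply (@term_fun_succ f); solve_term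
  | |- term_fun (fun e => @?f e + @?g e) =>
      apply (@term_fun_add f g); solve_term
  | |- term_fun (fun e => @?f e * @?g e) =>
      apply (@term_fun_mul f g); solve_term
  | |- term_fun (fun e => nth 0 _ ?i) => solve_term_leaf (term_fun_nth i) 20
  | |- term_fun (fun e => head 0 _) => solve_term_leaf term_fun_head 20
  | H : term_fun ?f |- term_fun (fun e => ?f _) => solve_term_leaf H 20
  | |- term_fun ?f => first [assumption | exact term_fun_head]
  end.

Lemma arith_eq f g : term_fun f -> term_fun g -> arith (fun _ e => f e = g e).
Proof. by case=> t Ht [u Hu]; exists (Eq t u) => X e /=; rewrite Ht Hu. Qed.

Lemma arith_in f : term_fun f -> arith (fun X e => X (f e)).
Proof. by case=> t Ht; exists (InX t) => X e /=; rewrite Ht. Qed.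

Lemma arith_not P : arith P -> arith (fun X e => ~ P X e).
Proof. by case=> p Hp; exists (Not p) => X e /=; rewrite Hp. Qed.

Lemma arith_and P Q : arith P -> arith Q -> arith (fun X e => P X e /\ Q X e).
Proof. by case=> p Hp [q Hq]; exists (And p q) => X e /=; rewrite Hp Hq. Qed.

Lemma arith_forall (Q : cantor -> nat -> seq nat -> Prop) :
  arith (fun X e => Q X (head 0 e) (behead e)) ->
  arith (fun X e => forall n, Q X n e).
Proof.
case=> p Hp; exists (Forall p) => X e /=.
by split=> H n; have := H n; rewrite (Hp X (n :: e)).
Qed.

Lemma arith_ext P Q : (forall X e, P X e <-> Q X e) -> arith P -> arith Q.
Proof. by move=> PQ [p Hp]; exists p => X e; rewrite Hp PQ. Qed.

Lemma arith_or P Q : arith P -> arith Q -> arith (fun X e => P X e \/ Q X e).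
Proof.
move=> HP HQ;
  apply: arith_ext (arith_not (arith_and (arith_not HP) (arith_not HQ))) => X e.
by rewrite -not_orP; split=> [/contrapT|H].
Qed.

Lemma arith_imp P Q : arith P -> arith Q -> arith (fun X e => P X e -> Q X e).
Proof.
move=> HP HQ; apply: arith_ext (arith_not (arith_and HP (arith_not HQ))) => X e.
split=> [H p|H [p]]; last by apply; apply: H.
by apply: contrapT => q; apply: H.
Qed.

Lemma arith_iff P Q : arith P -> arith Q -> arith (fun X e => P X e <-> Q X e).
Proof. by move=> HP HQ; apply: arith_and; apply: arith_imp. Qed.

Lemma arith_exists (Q : cantor -> nat -> seq nat -> Prop) :
  arith (fun X e => Q X (head 0 e) (behead e)) ->
  arith (fun X e => exists n, Q X n e).
Proof.
move=> H; apply: arith_ext (arith_not (arith_forall (Q := fun X n e =>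
  ~ Q X n e)
  (arith_not H))) => X e.
split=> [/existsNP[n /contrapT]|[n q] /(_ n)//]; by exists n.
Qed.

Lemma arith_le f g : term_fun f -> term_fun g -> arith (fun _ e => f e <= g e).
Proof.
move=> Hf Hg; apply: (@arith_ext (fun _ e => exists d, d + f e = g e)) =>
  [X e|].
  split=> [[d <-]|le]; first exact: leq_addl.
  by exists (g e - f e); rewrite subnK.
by apply: (arith_exists (Q := fun _ d e => d + f e = g e)); apply: arith_eq;
  solve_term.
Qed.

(** A hook, redefined whenever further relations have been shown arithmetical. *)
Ltac solve_arith_atom := fail.

Ltac solve_arith := cbv beta; lazymatch goal with
  | |- arith (fun _ e => @?f e = @?g e :> nat) =>
      first [solve_arith_atom | apply (@arith_eq f g); solve_term]
  | |- arith (fun _ e => is_true (@?f e <= @?g e)) =>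
      apply (@arith_le f g); solve_term
  | |- arith (fun X e => is_true (X (@?f e))) => apply (@arith_in f); solve_term
  | |- arith (fun X e => ~ @?P X e) => apply (@arith_not P); solve_arith
  | |- arith (fun X e => @?P X e <-> @?Q X e) =>
      apply (@arith_iff P Q); solve_arith
  | |- arith (fun X e => @?P X e /\ @?Q X e) =>
      apply (@arith_and P Q); solve_arith
  | |- arith (fun X e => @?P X e \/ @?Q X e) =>
      apply (@arith_or P Q); solve_arith
  | |- arith (fun X e => exists n, @?Q X n e) =>
      apply (@arith_exists Q); solve_arith
  | |- arith (fun X e => forall n : nat, @?Q X n e) =>
      apply (@arith_forall Q); solve_arith
  | |- arith (fun X e => @?P X e -> @?Q X e) =>
      apply (@arith_imp P Q); solve_arith
  | |- _ => first [solve_arith_atom | assumption]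
  end.

(** * Closure properties of $\Pi^1_1$ relations *)

Lemma pi11_ext P Q : (forall e, P e <-> Q e) -> pi11 P -> pi11 Q.
Proof. by move=> PQ [p Hp]; exists p => e; rewrite -PQ. Qed.

Lemma pi11_arith (R : seq nat -> Prop) : arith (fun _ => R) -> pi11 R.
Proof.
by case=> p Hp; exists p => e; split=> [r X|/(_ (fun=> true))/Hp//]; apply/Hp.
Qed.

Lemma pi11_all_sets R : arith R -> pi11 (fun e => forall X, R X e).
Proof. by case=> p Hp; exists p => e; split=> H X; apply/Hp/H. Qed.

Lemma pi11_subst R (s : seq nat -> seq nat) : pi11 R ->
  (forall i, term_fun (fun e => nth 0 (s e) i)) -> pi11 (fun e => R (s e)).
Proof.
case=> p Hp /choice[r Hr]; exists (subst r p) => e; rewrite Hp.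
by split=> H X; have := H X; rewrite (@holds_subst X p r e (s e)).
Qed.

Lemma pi11_and P Q : pi11 P -> pi11 Q -> pi11 (fun e => P e /\ Q e).
Proof.
case=> p Hp [q Hq]; exists (And p q) => e; rewrite Hp Hq /=.
by split=> [[K L] X|K]; split=> // X; case: (K X).
Qed.

Lemma pi11_forall (Q : nat -> seq nat -> Prop) :
  pi11 (fun e => Q (head 0 e) (behead e)) -> pi11 (fun e => forall n, Q n e).
Proof.
case=> p Hp; exists (Forall p) => e /=; split=> [H X n|H n].
  by have /(Hp (n :: e)) := H n; apply.
by apply/(Hp (n :: e)) => X; apply: H.
Qed.

(** By choice, if each n has a set refuting it, these sets are the rows of a single X. Hence the
    number quantifier moves inside: for every X, some n is satisfied by the n-th row of X.
    Disjunction is treated in the same way with rows 0 and 1. *)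
Lemma pi11_exists (Q : nat -> seq nat -> Prop) :
  pi11 (fun e => Q (head 0 e) (behead e)) -> pi11 (fun e => exists n, Q n e).
Proof.
case=> p Hp; exists (Not (Forall (Not (row_formula (Var 0) p)))) => e /=.
split=> [[n /(Hp (n :: e)) H] X /(_ n)|H].
  by apply; apply/holds_row/H.
apply: contrapT => /forallNP N.
have /choice[F HF] n : exists X, ~ holds X (n :: e) p.
  by apply/existsNP => K; apply: (N n); apply/(Hp (n :: e)).
have [u Hu] := unpair_ex.
apply: (H (fun z => F (u z).1 (u z).2)) => n /holds_row /=.
suff -> : (fun m => F (u (npair n m)).1 (u (npair n m)).2) = F n by apply: HF.
by apply/funext => m; rewrite Hu.
Qed.

Lemma pi11_or P Q : pi11 P -> pi11 Q -> pi11 (fun e => P e \/ Q e).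
Proof.
move=> [p Hp] [q Hq].
exists (Not (And (Not (row_formula Zero p)) (Not (row_formula (Succ Zero) q)))).
move=> e; split=> [[/Hp H|/Hq H] X /= [K L]|H].
- exact/K/holds_row/H.
- exact/L/holds_row/H.
apply: contrapT => /not_orP[/Hp/existsNP[X HX] /Hq/existsNP[Z HZ]].
have [u Hu] := unpair_ex.
apply: (H (fun z => if (u z).1 == 0 then X (u z).2 else Z (u z).2)).
split=> /holds_row /=.
  suff -> : (fun m => if (u (npair 0 m)).1 == 0 then X (u (npair 0 m)).2
                      else Z (u (npair 0 m)).2) = X by [].
  by apply/funext => m; rewrite Hu.
suff -> : (fun m => if (u (npair 1 m)).1 == 0 then X (u (npair 1 m)).2
                    else Z (u (npair 1 m)).2) = Z by [].
by apply/funext => m; rewrite Hu.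
Qed.

(** * The beta function *)

Definition beta (a c i : nat) : nat := a %% (i.+1 * c).+1.

Lemma betaE a c i v :
  beta a c i = v <-> v <= i.+1 * c /\ exists d, a = d * (i.+1 * c).+1 + v.
Proof.
rewrite /beta; split=> [<-|[le [d ->]]].
  by split; [rewrite -ltnS ltn_mod|exists (a %/ (i.+1 * c).+1); exact: divn_eq].
by rewrite modnMDl modn_small.
Qed.

(** A common divisor of the two moduli is prime to c and divides (j - i)c, hence divides j - i,
    hence N! and c itself; so it is 1. *)
Lemma beta_moduli_coprime N c i j : N`! %| c -> i < j <= N ->
  coprime (i.+1 * c).+1 (j.+1 * c).+1.
Proof.
move=> Nc /andP[ij jN]; rewrite /coprime; apply/eqP.
set g := gcdn _ _; have gi : g %| (i.+1 * c).+1 by apply: dvdn_gcdl.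
have gj : g %| (j.+1 * c).+1 by apply: dvdn_gcdr.
have gc : coprime g c.
  rewrite /coprime -dvdn1 -(dvdn_addr _ (dvdn_mull i.+1 (dvdn_gcdr g c))) addn1.
  exact: dvdn_trans (dvdn_gcdl g c) gi.
have : g %| (j - i) * c.
  have -> : (j - i) * c = (j.+1 * c).+1 - (i.+1 * c).+1.
    by rewrite subSS -mulnBl subSS.
  exact: dvdn_sub.
rewrite Gauss_dvdl // => gji.
have gc' : g %| c.
  apply: dvdn_trans gji (dvdn_trans _ Nc); apply: dvdn_fact; lia.
by move: gc; rewrite /coprime (gcdn_idPl gc') => /eqP.
Qed.

Lemma beta_surj (F : nat -> nat) n :
  exists a c, forall i, i < n -> beta a c i = F i.
Proof.
(* N bounds the indices, which makes the moduli coprime, and the values, which makes each of them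
   smaller than its modulus. *)
pose N := n + \max_(i < n) F i; pose c := N`!.
suff [a Ha] : exists a, forall i, i < n -> a = F i %[mod (i.+1 * c).+1].
  exists a, c => i lt; rewrite /beta Ha // modn_small // ltnS.
  have : F i <= N.
    rewrite /N (bigD1 (Ordinal lt)) //= maxnE; lia.
  have : N <= c by apply: fact_geq.
  have : c <= i.+1 * c by rewrite leq_pmull.
  lia.
have : n <= n by [].
elim: {-2}n => [|k IH] kn; first by exists 0.
have [a Ha] := IH (ltnW kn).
pose P := \prod_(i < k) (i.+1 * c).+1.
have cop : coprime P (k.+1 * c).+1.
  rewrite /P; apply: (big_ind (fun m => coprime m (k.+1 * c).+1)).
  - exact: coprime1n.
  - by move=> x y cx cy; rewrite coprimeMl cx.
  move=> i _.
  by apply: (@beta_moduli_coprime N) => //; rewrite ltn_ord /= /N; lia.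
exists (chinese P (k.+1 * c).+1 a (F k)) => i; rewrite ltnS leq_eqVlt.
case/orP=> [/eqP->|ik]; first exact: chinese_modr.
rewrite -(Ha _ ik).
have dv : (i.+1 * c).+1 %| P by rewrite /P (bigD1 (Ordinal ik)) //= dvdn_mulr.
by rewrite -(modn_dvdm _ dv) chinese_modl // modn_dvdm.
Qed.

Lemma arith_beta a c i v : term_fun a -> term_fun c -> term_fun i ->
  term_fun v ->
  arith (fun _ e => beta (a e) (c e) (i e) = v e).
Proof.
move=> Ha Hc Hi Hv; apply: arith_ext => [X e|]; first by symmetry; exact: betaE.
solve_arith.
Qed.

Ltac solve_arith_atom ::= lazymatch goal with
  | |- arith (fun _ e => beta (@?a e) (@?c e) (@?i e) = @?v e) =>
      apply (@arith_beta a c i v); solve_term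
  end.

(** * Relations enumerable with an oracle *)

Definition segment (A : cantor) (n : nat) : nat := code (mkseq A n).

Lemma code_surj n : exists s, code s = n.
Proof.
elim/ltn_ind: n => -[|n] IH; first by exists [::].
have [|s Hs] := IH n./2; first by lia.
by exists (odd n :: s); rewrite /= Hs; lia.
Qed.

Lemma drop_onth (s : bitstring) n b s' :
  drop n s = b :: s' -> drop n.+1 s = s' /\ onth s n = Some b.
Proof.
by elim: s n => [|x s IH] [|n] //=; [case=> -> ->; rewrite drop0|exact: IH].
Qed.

Lemma onth_drop (s : bitstring) n b :
  onth s n = Some b -> drop n s = b :: drop n.+1 s.
Proof.
by elim: s n => [|x s IH] [|n] //=; [case=> ->; rewrite drop0|exact: IH].
Qed.

(* The table lists the codes of the successive tails of the string coded by s. *)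
Definition has_bit (s n b : nat) : Prop :=
  exists a c, beta a c 0 = s /\
    (forall i u v, i.+1 <= n -> beta a c i = u -> beta a c i.+1 = v ->
       exists d, d <= 1 /\ u = v + v + d.+1) /\
    exists y u, b <= 1 /\ beta a c n = u /\ u = y + y + b.+1.

Lemma has_bit_code (s : bitstring) n b :
  has_bit (code s) n b <-> exists2 b' : bool, onth s n = Some b' & b = b'.
Proof.
(* In bijective base 2, the code of a nonempty string determines its first bit by parity, and then
   the code of its tail. *)
have code_drop i u d : d <= 1 -> code (drop i s) = u + u + d.+1 ->
    exists b' : bool, drop i s = b' :: drop i.+1 s /\ b' = d :> nat /\
      u = code (drop i.+1 s).
  move=> d1; case E: (drop i s) => [|b' s'] /=; first by lia.
  have [-> _] := drop_onth E; move=> Ec.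
  by exists b'; split=> //; case: b' {E} Ec => Ec; lia.
split=> [[a [c [E0 [step [y [u [b1 [En Eu]]]]]]]]|[b' onb ->]].
  have tails i : i <= n -> beta a c i = code (drop i s).
    elim: i => [|i IH] lt; first by rewrite drop0.
    have [d [d1]] := step i _ _ lt erefl erefl.
    rewrite IH; last exact: ltnW.
    by move=> /(code_drop _ _ _ d1)[b' [_ [_ ->]]].
  have [|b' [E [Eb _]]] := code_drop n y b b1; first by rewrite -tails ?En.
  by exists b'; [have [] := drop_onth E|].
have [a [c tab]] := beta_surj (fun i => code (drop i s)) n.+1.
exists a, c; split; first by rewrite tab // drop0.
split=> [i u v lt|].
  rewrite tab; last by lia.
  rewrite tab // => <- <-.
  have : i < size s.
    apply: leq_trans lt _; rewrite leqNgt; apply/negP => gt.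
    by move: onb; rewrite onth_default // ltnW.
  move=> /(drop_nth false) ->; exists (nth false s i); split;
    first by case: nth.
  by rewrite /= addnn.
exists (code (drop n.+1 s)), (code (drop n s)).
split; first by case: b' {onb}.
by rewrite tab // (onth_drop onb) /= addnn.
Qed.

Lemma onth_mkseq (X : cantor) m n b :
  onth (mkseq X m) n = Some b <-> n < m /\ X n = b.
Proof.
have [lt|ge] := ltnP n m; last first.
  by rewrite onth_default ?size_mkseq //; split=> // -[].
rewrite onthE (nth_map false) ?size_mkseq // nth_mkseq //.
by split=> [[->]|[_ ->]].
Qed.

Lemma has_bit_segment X m n b :
  has_bit (segment X m) n b <-> n < m /\ X n = b :> nat.
Proof.
rewrite has_bit_code; split=> [[b' /onth_mkseq[lt <-] ->]|[lt E]] //.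
by exists (X n); [apply/onth_mkseq|].
Qed.

Lemma arith_has_bit s n b : term_fun s -> term_fun n -> term_fun b ->
  arith (fun _ e => has_bit (s e) (n e) (b e)).
Proof. by move=> Hs Hn Hb; rewrite /has_bit; solve_arith. Qed.

Ltac solve_arith_atom ::= lazymatch goal with
  | |- arith (fun _ e => has_bit (@?s e) (@?n e) (@?b e)) =>
      apply (@arith_has_bit s n b); solve_term
  end.

Definition restricts_to (s k t : nat) : Prop :=
  (forall i, i.+1 <= k -> exists b, has_bit s i b) /\
  forall i b, has_bit t i b <-> i.+1 <= k /\ has_bit s i b.

Lemma restricts_to_segment A n k t :
  restricts_to (segment A n) k t <-> k <= n /\ t = segment A k.
Proof.
split=> [[all bits]|[kn ->]]; last first.
  split=> [i lt|i b]; last by rewrite !has_bit_segment; lia.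
  by exists (A i); apply/has_bit_segment; split=> //; lia.
have kn : k <= n.
  by case: k all {bits} => // k /(_ k (leqnn _))[b /has_bit_segment[]].
(* Every number codes a string, so t is determined by its bits. *)
split=> //; have [s Es] := code_surj t; rewrite -Es; congr code.
apply: eq_from_onth => i.
have onthE b : onth s i = Some b <-> onth (mkseq A k) i = Some b.
  have := bits i b; rewrite -Es has_bit_code has_bit_segment onth_mkseq => H.
  split=> [E|[lt E]].
    have [lt [_ Eb]] : i.+1 <= k /\ i < n /\ A i = b :> nat by apply/H;
      exists b.
    by split=> //; case: (A i) b Eb {E H} => -[].
  have [|b' E' Eb] := H.2; first by rewrite E; split=> //; lia.
  by rewrite E'; case: b b' Eb {H E E'} => -[].
case E: (onth s i) => [b|]; first by symmetry; apply/onthE.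
case E': (onth _ i) => [b|] //.
by have /onthE := E'; rewrite E.
Qed.

(* The witness W may only use the oracle through its initial segments, and is
   monotone in the length of the segment along A. *)
Definition oracle_ce (A : cantor) (R : seq nat -> Prop) : Prop :=
  exists W, [/\ pi11 W,
    forall n e, W (segment A n :: e) -> W (segment A n.+1 :: e) &
    forall e, R e <-> exists n, W (segment A n :: e)].

Lemma monotone_le A (W : seq nat -> Prop) :
  (forall n e, W (segment A n :: e) -> W (segment A n.+1 :: e)) ->
  forall n m e, n <= m -> W (segment A n :: e) -> W (segment A m :: e).
Proof.
by move=> up n m e le; rewrite -(subnK le); elim: (m - n) => // d IH /IH/up.
Qed.

Lemma term_fun_nth_behead k i : term_fun (fun e => nth 0 (iter k behead e) i).
Proof. exact: (term_fun_iter_behead k (term_fun_nth i)). Qed.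

Lemma pi11_behead R : pi11 R -> pi11 (fun e => R (behead e)).
Proof.
by move=> HR; apply: pi11_subst => // i; exact: (term_fun_nth_behead 1).
Qed.

Lemma oracle_ce_pi11 A R : pi11 R -> oracle_ce A R.
Proof.
move=> HR; exists (fun e => R (behead e)); split=> //; first exact: pi11_behead.
by move=> e; split=> [|[]//]; exists 0.
Qed.

Lemma oracle_ce_and A P Q : oracle_ce A P -> oracle_ce A Q ->
  oracle_ce A (fun e => P e /\ Q e).
Proof.
move=> [V [HV upV EV]] [W [HW upW EW]].
exists (fun e => V e /\ W e); split; first exact: pi11_and.
  by move=> n e [/upV v /upW w].
move=> e; rewrite EV EW; split=> [[[n v] [m w]]|[n [v w]]]; last first.
  by split; exists n.
exists (maxn n m).
split; first exact: (monotone_le upV (leq_maxl n m) v).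
exact: (monotone_le upW (leq_maxr n m) w).
Qed.

Lemma oracle_ce_or A P Q : oracle_ce A P -> oracle_ce A Q ->
  oracle_ce A (fun e => P e \/ Q e).
Proof.
move=> [V [HV upV EV]] [W [HW upW EW]].
exists (fun e => V e \/ W e); split; first exact: pi11_or.
  by move=> n e [/upV|/upW]; [left|right].
move=> e; rewrite EV EW; split=> [[[n v]|[n w]]|[n [v|w]]].
- by exists n; left.
- by exists n; right.
- by left; exists n.
- by right; exists n.
Qed.

Lemma pi11_second (W : seq nat -> Prop) : pi11 W ->
  pi11 (fun e => W (head 0 (behead e) :: head 0 e :: behead (behead e))).
Proof.
move=> HW; apply: pi11_subst => // -[|[|i]] /=; [solve_term|solve_term|].
exact: (term_fun_nth_behead 2).
Qed.

Lemma oracle_ce_exists A (Q : nat -> seq nat -> Prop) :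
  oracle_ce A (fun e => Q (head 0 e) (behead e)) ->
  oracle_ce A (fun e => exists n, Q n e).
Proof.
case=> W [HW up E].
exists (fun e => exists y, W (head 0 e :: y :: behead e)); split.
- apply: (@pi11_exists (fun y e => W (head 0 e :: y :: behead e))).
  exact: pi11_second.
- by move=> n e [y /= /up]; exists y.
move=> e; split=> [[y /(E (y :: e))[n w]]|[n [y w]]]; first by exists n, y.
by exists y; apply/(E (y :: e)); exists n.
Qed.

(** Only finitely many witnesses are involved, so by monotonicity one segment of the oracle, the
    longest of those required, serves them all. *)
Lemma oracle_ce_ball A f (Q : nat -> seq nat -> Prop) : term_fun f ->
  oracle_ce A (fun e => Q (head 0 e) (behead e)) ->
  oracle_ce A (fun e => forall y, y <= f e -> Q y e).
Proof.
move=> Hf [W [HW up E]].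
exists (fun e => forall y, (f (behead e)).+1 <= y \/
  W (head 0 e :: y :: behead e)).
split.
- apply: (@pi11_forall (fun y e =>
    (f (behead e)).+1 <= y \/ W (head 0 e :: y :: behead e))).
  by apply: pi11_or; [apply: pi11_arith; solve_arith|exact: pi11_second].
- by move=> n e H y; have [|/= /up] := H y; [left|right].
move=> e; split=> [|[n H] y le] /=; last first.
  by have [/=|/= w] := H y; [lia|apply/(E (y :: e)); exists n].
elim: {f Hf}(f e) => [|b IH] H.
  have /(E (0 :: e))[n w] := H 0 isT; exists n => -[|y]; by [right|left].
have [n Hn] := IH (fun y le => H y (leqW le)).
have /(E (b.+1 :: e))[m w] := H b.+1 (leqnn _).
exists (maxn n m) => y.
have [lt|gt|->] := ltngtP y b.+1; last 2 first.
- by left.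
- by right; apply: (monotone_le up (leq_maxr n m) w).
have [|v] := Hn y; first by lia.
by right; apply: (monotone_le up (leq_maxl n m) v).
Qed.

(** Any sufficiently long segment of the oracle confirms the equation by arithmetical comparison of
    bits. *)
Lemma oracle_ce_segment A f g : term_fun f -> term_fun g ->
  oracle_ce A (fun e => g e = segment A (f e)).
Proof.
move=> Hf Hg.
exists (fun e => restricts_to (head 0 e) (f (behead e)) (g (behead e))); split.
- by apply: pi11_arith; rewrite /restricts_to; solve_arith.
- by move=> n e /= /restricts_to_segment[le E]; apply/restricts_to_segment;
  split=> //; lia.
move=> e /=; split=> [E|[n /restricts_to_segment[]//]].
by exists (f e); apply/restricts_to_segment.
Qed.

Lemma oracle_ce_subst_segment A f (Q : nat -> seq nat -> Prop) : term_fun f ->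
  oracle_ce A (fun e => Q (head 0 e) (behead e)) ->
  oracle_ce A (fun e => Q (segment A (f e)) e).
Proof.
move=> Hf HQ.
have : oracle_ce A (fun e => exists t, t = segment A (f e) /\ Q t e).
  apply: (@oracle_ce_exists _ (fun t e => t = segment A (f e) /\ Q t e)).
  by apply: oracle_ce_and => //; apply: oracle_ce_segment; solve_term.
case=> W [HW up E]; exists W; split=> // e; rewrite -E.
by split=> [q|[t [-> //]]]; exists (segment A (f e)).
Qed.

(** * Truth tables *)

(** The tags 0 to 4 mark terms and 5 to 9 formulas; 10 is kept for the entries of a table that
    describe the set X. *)
Fixpoint tcode (t : term) : nat :=
  match t with
  | Var i => npair 0 i
  | Zero => npair 1 0
  | Succ t => npair 2 (tcode t)
  | Add t u => npair 3 (npair (tcode t) (tcode u))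
  | Mul t u => npair 4 (npair (tcode t) (tcode u))
  end.

Fixpoint fcode (p : arith_formula) : nat :=
  match p with
  | Eq t u => npair 5 (npair (tcode t) (tcode u))
  | InX t => npair 6 (tcode t)
  | Not p => npair 7 (fcode p)
  | And p q => npair 8 (npair (fcode p) (fcode q))
  | Forall p => npair 9 (fcode p)
  end.

Fixpoint ecode (e : seq nat) : nat :=
  if e is n :: e' then (npair n (ecode e')).+1 else 0.

Lemma tcode_inj : injective tcode.
Proof.
elim=> [i||t IH|t IHt u IHu|t IHt u IHu] [i'||t'|t' u'|t' u'] /= /npair_inj[] //.
- by move=> _ ->.
- by move=> _ /IH->.
- by move=> _ /npair_inj[/IHt-> /IHu->].
- by move=> _ /npair_inj[/IHt-> /IHu->].
Qed.

Lemma fcode_inj : injective fcode.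
Proof.
elim=> [t u|t|p IH|p IHp q IHq|p IH] [t' u'|t'|p'|p' q'|p'] /= /npair_inj[] //.
- by move=> _ /npair_inj[/tcode_inj-> /tcode_inj->].
- by move=> _ /tcode_inj->.
- by move=> _ /IH->.
- by move=> _ /npair_inj[/IHp-> /IHq->].
- by move=> _ /IH->.
Qed.

Lemma ecode_inj : injective ecode.
Proof. by elim=> [|n e IH] [|n' e'] //= [/npair_inj[-> /IH->]]. Qed.

Lemma tcode_fcode t p : tcode t <> fcode p.
Proof.
by case: t => [i||t|t u|t u]; case: p => [t' u'|t'|p|p q|p] /npair_inj[].
Qed.

(* A table F assigns to [npair c e] the value of the term or formula coded by c
   in the environment coded by e: 0 means undefined, a term of value v gets
   v + 1, a true formula gets 1, and a false formula gets at least 2, with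
   m + 2 recording a counterexample m to a universal formula. The entry at
   [npair (npair 10 n.+1) 0] is 1 if and only if n belongs to X. *)
Definition local_ok (i x j y k z : nat) : Prop :=
  forall c e, i = npair c e -> 0 < x ->
  (forall n, c = npair 0 n -> e = 0 -> x = 1) /\
  (forall m e', c = npair 0 0 -> e = (npair m e').+1 -> x = m.+1) /\
  (forall n m e', c = npair 0 n.+1 -> e = (npair m e').+1 ->
     j = npair (npair 0 n) e' -> x = y) /\
  (forall n, c = npair 1 n -> x = 1) /\
  (forall t, c = npair 2 t -> j = npair t e -> 0 < y /\ x = y.+1) /\
  (forall t u, c = npair 3 (npair t u) -> j = npair t e -> k = npair u e ->
     exists a b, y = a.+1 /\ z = b.+1 /\ x = (a + b).+1) /\
  (forall t u, c = npair 4 (npair t u) -> j = npair t e -> k = npair u e ->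
     exists a b, y = a.+1 /\ z = b.+1 /\ x = (a * b).+1) /\
  (forall t u, c = npair 5 (npair t u) -> j = npair t e -> k = npair u e ->
     0 < y /\ 0 < z /\ (x = 1 <-> y = z)) /\
  (forall t, c = npair 6 t -> j = npair t e ->
     0 < y /\ (k = npair (npair 10 y) 0 -> (x = 1 <-> z = 1))) /\
  (forall p, c = npair 7 p -> j = npair p e -> 0 < y /\ (x = 1 <-> 1 < y)) /\
  (forall p q, c = npair 8 (npair p q) -> j = npair p e -> k = npair q e ->
     0 < y /\ 0 < z /\ (x = 1 <-> y = 1 /\ z = 1)) /\
  (forall p m, c = npair 9 p -> j = npair p (npair m e).+1 ->
     (x = 1 -> y = 1) /\ (x = m.+2 -> 1 < y)).

Lemma arith_local_ok i x j y k z : term_fun i -> term_fun x -> term_fun j ->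
  term_fun y -> term_fun k -> term_fun z ->
  arith (fun _ e => local_ok (i e) (x e) (j e) (y e) (k e) (z e)).
Proof. by move=> Hi Hx Hj Hy Hk Hz; rewrite /local_ok; solve_arith. Qed.

Definition table_ok (F : nat -> nat) : Prop :=
  forall i j k, local_ok i (F i) j (F j) k (F k).

(** A defined entry forces the entries that it depends on to be defined, so induction applies
    although F may be undefined elsewhere. *)
Lemma table_term F t e : table_ok F ->
  0 < F (npair (tcode t) (ecode e)) ->
  F (npair (tcode t) (ecode e)) = (eval e t).+1.
Proof.
move=> F_ok; elim: t => [i||t IH|t IHt u IHu|t IHt u IHu] /= pos.
- elim: e i pos => [|m e IH] i pos.
    have [H _] := F_ok _ 0 0 _ _ erefl pos.
    by rewrite (H i) // nth_nil.
  case: i pos => [|i] pos.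
    have [_ [H _]] := F_ok _ 0 0 _ _ erefl pos.
    exact: (H m (ecode e)).
  have [_ [_ [H _]]] := F_ok _ (npair (npair 0 i) (ecode e)) 0 _ _ erefl pos.
  have E := H i m (ecode e) erefl erefl erefl.
  by rewrite E; apply: IH; rewrite -E.
- have [_ [_ [_ [H _]]]] := F_ok _ 0 0 _ _ erefl pos.
  exact: (H 0).
- have [_ [_ [_ [_ [H _]]]]] := F_ok _ (npair (tcode t) (ecode e)) 0 _ _ erefl pos.
  by have [/IH <-] := H _ erefl erefl.
- have [_ [_ [_ [_ [_ [H _]]]]]] :=
    F_ok _ (npair (tcode t) (ecode e)) (npair (tcode u) (ecode e)) _ _ erefl pos.
  have [a [b [Ea [Eb ->]]]] := H _ _ erefl erefl erefl.
  by have [] := (IHt, IHu); rewrite Ea Eb => /(_ isT)[->] /(_ isT)[->].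
- have [_ [_ [_ [_ [_ [_ [H _]]]]]]] :=
    F_ok _ (npair (tcode t) (ecode e)) (npair (tcode u) (ecode e)) _ _ erefl pos.
  have [a [b [Ea [Eb ->]]]] := H _ _ erefl erefl erefl.
  by have [] := (IHt, IHu); rewrite Ea Eb => /(_ isT)[->] /(_ isT)[->].
Qed.

Lemma table_formula F p e : table_ok F ->
  0 < F (npair (fcode p) (ecode e)) ->
  F (npair (fcode p) (ecode e)) = 1 <->
  holds (fun n => F (npair (npair 10 n.+1) 0) == 1) e p.
Proof.
move=> F_ok; elim: p e => [t u|t|p IH|p IHp q IHq|p IH] e /= pos.
- have [_ [_ [_ [_ [_ [_ [_ [H _]]]]]]]] :=
    F_ok _ (npair (tcode t) (ecode e)) (npair (tcode u) (ecode e)) _ _ erefl pos.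
  have [/(table_term F_ok) -> [/(table_term F_ok) ->
    ->]] := H _ _ erefl erefl erefl.
  by split=> [[]|->].
- have Hk k := F_ok _ (npair (tcode t) (ecode e)) k _ _ erefl pos.
  have [_ [_ [_ [_ [_ [_ [_ [_ [H _]]]]]]]]] :=
    Hk (npair (npair 10 (eval e t).+1) 0).
  have [/(table_term F_ok) -> /(_ erefl) ->] := H _ erefl erefl.
  by split=> [/eqP|/eqP].
- have [_ [_ [_ [_ [_ [_ [_ [_ [_ [H _]]]]]]]]]] :=
    F_ok _ (npair (fcode p) (ecode e)) 0 _ _ erefl pos.
  have [y ->] := H _ erefl erefl.
  by rewrite -(IH _ y); lia.
- have [_ [_ [_ [_ [_ [_ [_ [_ [_ [_ [H _]]]]]]]]]]] :=
    F_ok _ (npair (fcode p) (ecode e)) (npair (fcode q) (ecode e)) _ _ erefl pos.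
  have [y [z ->]] := H _ _ erefl erefl erefl.
  by rewrite (IHp _ y) (IHq _ z).
- have Hj m := F_ok _ (npair (fcode p) (npair m (ecode e)).+1) 0 _ _ erefl pos.
  have {}Hj m : (F (npair (npair 9 (fcode p)) (ecode e)) = 1 ->
      F (npair (fcode p) (ecode (m :: e))) = 1) /\
    (F (npair (npair 9 (fcode p)) (ecode e)) = m.+2 ->
      1 < F (npair (fcode p) (ecode (m :: e)))).
    have [_ [_ [_ [_ [_ [_ [_ [_ [_ [_ [_ H]]]]]]]]]]] := Hj m.
    exact: H.
  split=> [one m|all].
    by have [/(_ one) E _] := Hj m; apply/IH; rewrite E.
  (* An entry m + 2 would make the instance at m false, against the assumption that all instances
     hold. *)
  case E: (F _) pos Hj => [|[|m]] // _ Hj.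
  have [_ /(_ erefl) lt] := Hj m.
  by have /IH := all m; lia.
Qed.

Lemma table_exists (X : cantor) : exists F : nat -> nat,
  table_ok F /\
  forall p e, ~ holds X e p -> 1 < F (npair (fcode p) (ecode e)).
Proof.
pose fval p e x := (x = 1 /\ holds X e p) \/
  (1 < x /\ ~ holds X e p /\
   forall q, p = Forall q -> ~ holds X (x.-2 :: e) q).
pose val z x :=
  (exists t e, z = npair (tcode t) (ecode e) /\ x = (eval e t).+1) \/
  (exists p e, z = npair (fcode p) (ecode e) /\ fval p e x) \/
  (exists n, z = npair (npair 10 n.+1) 0 /\ x = if X n then 1 else 2).
(* Numbers that code no entry get the default 0, that is, undefined. For a false universal formula
   the choice made here selects a counterexample. *)
pose F z := xget 0 [set x | val z x].
have fval_ex p e : exists x, fval p e x.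
  have [h|h] := pselect (holds X e p); first by exists 1; left.
  case: p h => [t u|t|p|p q|p] h; try by exists 2; right.
  have /existsNP[m Hm] := h.
  by exists m.+2; right; split=> //; split=> // q [<-].
have F_val z : 0 < F z -> val z (F z).
  by rewrite /F; case: xgetP.
have val_F z x : val z x -> val z (F z).
  by move=> v; rewrite /F; case: xgetP => // /(_ x).
have Ft t e : F (npair (tcode t) (ecode e)) = (eval e t).+1.
  have /val_F : val (npair (tcode t) (ecode e)) (eval e t).+1.
    by left; exists t, e.
  case=> [[t' [e' [/npair_inj[/tcode_inj-> /ecode_inj->] ->]]]|] //.
  case=> [[p [e' [/npair_inj[/tcode_fcode]]]]|] //.
  by case=> n [/npair_inj[E _]]; case: t E => [i||t|t u|t u] /npair_inj[].
have Ff p e : fval p e (F (npair (fcode p) (ecode e))).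
  have [x fx] := fval_ex p e.
  have /val_F : val (npair (fcode p) (ecode e)) x by right; left; exists p, e.
  case=> [[t [e' [/npair_inj[/esym/tcode_fcode]]]]|] //.
  case=> [[p' [e' [/npair_inj[/fcode_inj-> /ecode_inj->]]]]|] //.
  by case=> n [/npair_inj[E _]]; case: p fx E => [t u|t|p|p q|p] _ /npair_inj[].
have FX n : F (npair (npair 10 n.+1) 0) = if X n then 1 else 2.
  have /val_F : val (npair (npair 10 n.+1) 0) (if X n then 1 else 2).
    by right; right; exists n.
  case=> [[t [e [/npair_inj[E _] _]]]|].
    by case: t E => [i||t|t u|t u] /npair_inj[].
  case=> [[p [e [/npair_inj[E _] _]]]|].
    by case: p E => [t u|t|p|p q|p] /npair_inj[].
  by case=> n' [/npair_inj[/npair_inj[_ [->]] _] ->].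
have F1 p e : F (npair (fcode p) (ecode e)) = 1 <-> holds X e p.
  by have [[-> h]|[lt [h _]]] := Ff p e; split=> //; lia.
have F0 p e : 0 < F (npair (fcode p) (ecode e)).
  by have [[-> h]|[lt [h _]]] := Ff p e; lia.
exists F; split=> [i j k c e -> {i}|p e h]; last first.
  have : F (npair (fcode p) (ecode e)) <> 1 by move/F1.
  by have := F0 p e; lia.
move=> /[dup] pos /F_val.
case=> [[t [e0 [/npair_inj[-> ->] ->]]]|].
  case: t => [i||t|t u|t u] /=;
    refine (conj _ (conj _ (conj _ (conj _ (conj _ (conj _ (conj _ (conj _
      (conj _ (conj _ (conj _ _)))))))))));
    try by move=> > /npair_inj[].
  - by move=> n _; case: e0 => //; rewrite nth_nil.
  - by move=> m e' /npair_inj[_ ->]; case: e0 => //= n e0 [/npair_inj[->]].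
  - move=> n m e' /npair_inj[_ ->]; case: e0 => //= m' e0 [/npair_inj[_ <-]] ->.
    by rewrite (Ft (Var n)).
  - by move=> t' /npair_inj[_ <-] ->; rewrite Ft.
  - move=> t' u' /npair_inj[_ /npair_inj[<- <-]] -> ->.
    by exists (eval e0 t), (eval e0 u); rewrite !Ft.
  - move=> t' u' /npair_inj[_ /npair_inj[<- <-]] -> ->.
    by exists (eval e0 t), (eval e0 u); rewrite !Ft.
case=> [[p [e0 [/npair_inj[-> ->] _]]]|]; last first.
  case=> n [/npair_inj[-> ->] _].
  refine (conj _ (conj _ (conj _ (conj _ (conj _ (conj _ (conj _ (conj _
    (conj _ (conj _ (conj _ _)))))))))));
  by move=> > /npair_inj[].
have F2 q e' : ~ holds X e' q -> 1 < F (npair (fcode q) (ecode e')).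
  by move=> /F1; have := F0 q e'; lia.
case: p => [t u|t|p|p q|p];
  refine (conj _ (conj _ (conj _ (conj _ (conj _ (conj _ (conj _ (conj _
    (conj _ (conj _ (conj _ _)))))))))));
  try by move=> > /npair_inj[].
- move=> t' u' /npair_inj[_ /npair_inj[<- <-]] -> ->.
  by rewrite F1 !Ft /=; split=> //; split=> //; split=> [->|[]].
- move=> t' /npair_inj[_ <-] ->; rewrite Ft; split=> // ->.
  by rewrite F1 FX /=; case: (X _).
- move=> p' /npair_inj[_ <-] ->; rewrite F1 /=; split=> //.
  by split=> [/F2//|lt /F1 E]; rewrite E in lt.
- move=> p' q' /npair_inj[_ /npair_inj[<- <-]] -> ->.
  by rewrite !F1 /=.
- move=> p' m /npair_inj[_ <-] ->; rewrite F1 -/(ecode (m :: e0)) F1 /=.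
  split=> [|E]; first by apply.
  have [[E1]|[_ [_ /(_ _ erefl)]]] := Ff (Forall p) e0;
    first by rewrite E1 in E.
  by rewrite E => /F2.
Qed.

(** * A universal set and its norm *)

Definition node q L a c := npair q (npair L (npair a c)).

(* The node [node q L a c] is an attempt at the first L values of a table in
   which the entry q is false. *)
Definition child (s' s : nat) : Prop :=
  exists q L a c a' c', s = node q L a c /\ s' = node q L.+1 a' c' /\
    (forall i v, i.+1 <= L -> beta a c i = v -> beta a' c' i = v) /\
    (forall i x j y k z, i <= L -> j <= L -> k <= L ->
       beta a' c' i = x -> beta a' c' j = y -> beta a' c' k = z ->
       local_ok i x j y k z) /\
    (forall v, q <= L -> beta a' c' q = v -> 2 <= v).

Ltac solve_arith_atom ::= lazymatch goal with
  | |- arith (fun _ e => beta (@?a e) (@?c e) (@?i e) = @?v e) =>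
      apply (@arith_beta a c i v); solve_term
  | |- arith (fun _ e =>
    local_ok (@?i e) (@?x e) (@?j e) (@?y e) (@?k e) (@?z e)) =>
      apply (@arith_local_ok i x j y k z); solve_term
  end.

Lemma arith_child f g : term_fun f -> term_fun g ->
  arith (fun _ e => child (f e) (g e)).
Proof.
move=> Hf Hg; rewrite /child /node; solve_arith.
Qed.

Ltac solve_arith_atom ::= lazymatch goal with
  | |- arith (fun _ e => has_bit (@?s e) (@?n e) (@?b e)) =>
      apply (@arith_has_bit s n b); solve_term
  | |- arith (fun _ e => child (@?f e) (@?g e)) =>
      apply (@arith_child f g); solve_term
  end.

Lemma Acc_no_chain T (R : T -> T -> Prop) (f : nat -> T) n :
  (forall n, R (f n.+1) (f n)) -> ~ Acc R (f n).
Proof.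
move=> chain acc; move E: (f n) acc => a acc.
elim: acc n E => {}a _ IH n E.
by apply: (IH (f n.+1) _ n.+1) => //; rewrite -E.
Qed.

Lemma not_Acc_chain T (R : T -> T -> Prop) a : ~ Acc R a ->
  exists2 f, f 0 = a & forall n, R (f n.+1) (f n).
Proof.
move=> na.
have step (x : {x | ~ Acc R x}) :
  exists y : {x | ~ Acc R x}, R (sval y) (sval x).
  case: x => x nx /=; apply: contrapT => /forallNP N; apply: nx;
    constructor => y Ryx.
  by apply: contrapT => ny; apply: (N (exist _ y ny)).
have [h Hh] := choice step.
exists (fun n => sval (iter n h (exist _ a na))) => // n.
exact: Hh.
Qed.

Definition wf_node (s : nat) : Prop := Acc child s.

Definition root (g : nat) (e : seq nat) : nat := node (npair g (ecode e)) 0 0 0.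

(** A normal form theorem: an infinite path from the root amounts to a correct table in which the
    entry q is false, and such a table exists exactly when some X falsifies the formula. *)
Lemma wf_node_universal p e :
  wf_node (root (fcode p) e) <-> forall X, holds X e p.
Proof.
set q := npair (fcode p) (ecode e).
split=> [acc X|all].
  apply: contrapT => /[dup] np; have [F [Fok F2]] := table_exists X => /F2 lt.
  have : forall n, exists ac : nat * nat,
    (n = 0 -> ac = (0, 0)) /\ forall i, i < n -> beta ac.1 ac.2 i = F i.
    case=> [|n]; first by exists (0, 0).
    by have [a [c H]] := beta_surj F n.+1; exists (a, c).
  case/choice=> f Hf.
  apply: (@Acc_no_chain _ child (fun n => node q n (f n).1 (f n).2) 0);
    last first.
    by have [/(_ erefl) -> _] := Hf 0.
  move=> n; exists q, n, (f n).1, (f n).2, (f n.+1).1, (f n.+1).2.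
  have [[_ Hn] [_ Hn1]] := (Hf n, Hf n.+1).
  split=> //; split=> //; split; [|split].
  - by move=> i v lti <-; rewrite Hn // Hn1 // ltnS ltnW.
  - by move=> i x j y k z ? ? ? <- <- <-; rewrite !Hn1.
  - by move=> v ? <-; rewrite Hn1.
apply: contrapT => nacc; have [f f0 chain] := not_Acc_chain nacc.
have : forall n, exists ac, f n = node q n ac.1 ac.2.
  elim=> [|n [[a c] E]]; first by exists (0, 0).
  have [q' [L [a0 [c0 [a' [c' [E1 [-> _]]]]]]]] := chain n.
  exists (a', c'); move: E1; rewrite E => /npair_inj[<- /npair_inj[<- _]] //.
case/choice=> s Hs.
have {chain}step n :
  (forall i, i < n -> beta (s n.+1).1 (s n.+1).2 i = beta (s n).1 (s n).2 i) /\
  (forall i j k, i <= n -> j <= n -> k <= n ->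
    let b := beta (s n.+1).1 (s n.+1).2 in
    local_ok i (b i) j (b j) k (b k)) /\
  (q <= n -> 2 <= beta (s n.+1).1 (s n.+1).2 q).
  have [q' [L [a [c [a' [c' [E1 [E2 [H1 [H2 H3]]]]]]]]]] := chain n.
  move: E1 E2; rewrite !Hs => /npair_inj[Eq /npair_inj[EL /npair_inj[Ea Ec]]].
  move=> /npair_inj[_ /npair_inj[_ /npair_inj[Ea' Ec']]].
  rewrite Ea Ec Ea' Ec' Eq EL; split; first by move=> i lt; apply: (H1 i).
  split=> [i j k ? ? ?|lt]; first exact: H2.
  exact: H3.
(* The limit of the path: entry i is first present at length i + 1 and is preserved from then on. *)
pose F i := beta (s i.+1).1 (s i.+1).2 i.
have FE i n : i < n -> beta (s n).1 (s n).2 i = F i.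
  elim: n => // n IH; rewrite ltnS leq_eqVlt => /orP[/eqP->//|lt].
  by have [H _] := step n; rewrite H // IH.
have Fok i j k : local_ok i (F i) j (F j) k (F k).
  pose n := maxn i (maxn j k).
  have [_ [H _]] := step n.
  have := H i j k; rewrite /= !(FE _ n.+1) /n; try lia.
  by apply; lia.
have F2 : 1 < F q by have [_ [_]] := step q; apply.
have := table_formula Fok (p := p) (e := e) (ltnW F2).
by move=> [_ /(_ (all _))] E; rewrite -/q E in F2.
Qed.

(** The accessible part is the intersection of all sets that contain each node whose children they
    contain. *)
Lemma pi11_wf_node f : term_fun f -> pi11 (fun e => wf_node (f e)).
Proof.
move=> Hf.
have : pi11 (fun e => forall X : cantor,
    (forall a, (forall a', child a' a -> X a') -> X a) -> X (f e)).
  by apply: pi11_all_sets; solve_arith.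
apply: pi11_ext => e; split=> [H|acc X H].
  apply/asboolP; apply: (H (fun a => `[<wf_node a>])) => a Ha.
  by apply/asboolP; constructor => a' /Ha/asboolP.
by elim: acc => a _; apply: H.
Qed.

(* For accessible [a], [stage_le a b] says that the rank of [a] is at most the
   rank of [b], inaccessible nodes having rank infinity. *)
Definition stage_le (a b : nat) : Prop := forall X : cantor,
  (forall a b, (forall a', child a' a ->
     exists b', child b' b /\ X (npair a' b')) -> X (npair a b)) ->
  X (npair a b).

(** With [stage_le], this makes the rank a $\Pi^1_1$ norm: both comparisons of an accessible a with
    an arbitrary b are $\Pi^1_1$. *)
Definition stage_lt (a b : nat) : Prop :=
  exists b', child b' b /\ stage_le a b'.

Lemma pi11_stage_le f g : term_fun f -> term_fun g ->
  pi11 (fun e => stage_le (f e) (g e)).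
Proof.
by move=> Hf Hg; apply: pi11_all_sets; solve_arith.
Qed.

Lemma stage_le_intro a b :
  (forall a', child a' a -> exists b', child b' b /\ stage_le a' b') ->
  stage_le a b.
Proof.
move=> H X HX; apply: (HX) => a' /H[b' [pb le]].
by exists b'; split=> //; apply: le.
Qed.

(** [stage_le] is the least relation closed under its defining step, and the unfolded relation is
    closed under that step too. *)
Lemma stage_le_elim a b : stage_le a b ->
  forall a', child a' a -> exists b', child b' b /\ stage_le a' b'.
Proof.
pose X : cantor := fun z => `[<exists a b, z = npair a b /\
  forall a', child a' a -> exists b', child b' b /\ stage_le a' b'>].
move=> le; have /asboolP[a0 [b0 [/npair_inj[-> ->] //]]] : X (npair a b).
apply: le => {}a {}b H.
apply/asboolP; exists a, b; split=>
  [//|a' /H[b' [pb /asboolP[a0 [b0 [E le]]]]]].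
exists b'; split; first exact: pb.
by apply: stage_le_intro; case/npair_inj: E => -> ->.
Qed.

Lemma stage_le_wf a b : stage_le a b -> wf_node a.
Proof.
pose X : cantor := fun z => `[<exists a b, z = npair a b /\ wf_node a>].
move=> le; have /asboolP[a0 [b0 [/npair_inj[-> _] //]]] : X (npair a b).
apply: le => {}a {}b H.
apply/asboolP; exists a, b; split=> [//|]; constructor => a' /H.
by case=> b' [_ /asboolP[a0 [b0 [/npair_inj[-> _] acc]]]].
Qed.

Lemma stage_le_refl a : wf_node a -> stage_le a a.
Proof.
elim=> {}a _ IH; apply: stage_le_intro => a' pa; exists a'; split=> //.
exact: IH.
Qed.

Lemma stage_le_trans a b c : stage_le a b -> stage_le b c -> stage_le a c.
Proof.
move=> ab; have acc := stage_le_wf ab; elim: acc b c ab => {}a _ IH b c ab bc.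
apply: stage_le_intro => a' pa.
have [b' [pb ab']] := stage_le_elim ab pa.
have [c' [pc bc']] := stage_le_elim bc pb.
by exists c'; split=> //; apply: IH ab' bc'.
Qed.

Lemma stage_le_child a b b' : stage_le a b' -> child b' b -> stage_le a b.
Proof.
move=> ab; have acc := stage_le_wf ab; elim: acc b b' ab => {}a _ IH b b' ab pb.
apply: stage_le_intro => a' pa; exists b'; split=> //.
have [b'' [pb' ab']] := stage_le_elim ab pa.
exact: IH ab' pb'.
Qed.

Lemma stage_ltW a b : stage_lt a b -> stage_le a b.
Proof. by case=> b' [pb ab]; apply: stage_le_child ab pb. Qed.

Lemma stage_lt_irrefl a : ~ stage_lt a a.
Proof.
case=> a' [pa aa]; have acc := stage_le_wf aa; elim: acc a' pa aa =>
  {}a _ IH a' pa aa.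
have [a'' [pa' aa']] := stage_le_elim aa pa.
exact: IH pa _ pa' aa'.
Qed.

Lemma stage_lt_leF a b : stage_lt a b -> ~ stage_le b a.
Proof.
case=> b' [pb ab] ba; have [a' [pa le]] := stage_le_elim ba pb.
by apply: (@stage_lt_irrefl a); exists a'; split=> //; apply: stage_le_trans le.
Qed.

(** Some child b' of b is not below any child of a. By induction every child of a is then strictly
    below b', which puts a itself at or below b'. *)
Lemma stage_ltNge a b : wf_node a -> ~ stage_le b a -> stage_lt a b.
Proof.
move=> acc; elim: acc b => {}a _ IH b nle.
have [b' [pb N]] : exists b', child b' b /\
    forall a', child a' a -> ~ stage_le b' a'.
  apply: contrapT => /forallNP K; apply: nle; apply: stage_le_intro => b' pb.
  apply: contrapT => /forallNP L; apply: (K b'); split=> // a' pa le.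
  exact: (L a').
exists b'; split=> //; apply: stage_le_intro => a' pa.
exact/(IH a' pa)/N.
Qed.

Lemma pi11_stage_lt f g : term_fun f -> term_fun g ->
  pi11 (fun e => stage_lt (f e) (g e)).
Proof.
move=> Hf Hg; apply: pi11_exists; apply: pi11_and; first by apply: pi11_arith;
  solve_arith.
by apply: (@pi11_stage_le (fun e => f (behead e)) (head 0)); solve_term.
Qed.

Ltac solve_pi11 := cbv beta; lazymatch goal with
  | |- pi11 (fun e => wf_node (@?f e)) => apply (@pi11_wf_node f); solve_term
  | |- pi11 (fun e => stage_le (@?f e) (@?g e)) =>
      apply (@pi11_stage_le f g); solve_term
  | |- pi11 (fun e => stage_lt (@?f e) (@?g e)) =>
      apply (@pi11_stage_lt f g); solve_term
  | |- pi11 (fun e => @?P e /\ @?Q e) => apply (@pi11_and P Q); solve_pi11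
  | |- pi11 (fun e => @?P e \/ @?Q e) => apply (@pi11_or P Q); solve_pi11
  | |- pi11 (fun e => exists n, @?Q n e) => apply (@pi11_exists Q); solve_pi11
  | |- pi11 (fun e => forall n : nat, @?Q n e) =>
      apply (@pi11_forall Q); solve_pi11
  | |- _ => first [assumption | apply pi11_arith; solve_arith | idtac]
  end.

(** * Self-PA oracles *)

(* [wf_node (event g t n b)] says that the functional with index g, given an
   oracle extending the string coded by t, enumerates the value b at n. *)
Definition event (g t n b : nat) : nat :=
  npair (npair g (npair t (npair n (npair b 0).+1).+1).+1) (npair 0 (npair 0 0)).

Lemma term_fun_event g t n b : term_fun g -> term_fun t -> term_fun n ->
  term_fun b ->
  term_fun (fun e => event (g e) (t e) (n e) (b e)).
Proof. by move=> Hg Ht Hn Hb; rewrite /event; solve_term. Qed.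

Lemma event_universal (W : nat -> nat -> nat -> Prop) :
  pi11 (fun e => W (nth 0 e 0) (nth 0 e 1) (nth 0 e 2)) ->
  exists g, forall t n b, W t n b <-> wf_node (event g t n b).
Proof.
case=> p Hp; exists (fcode p) => t n b.
(* [event] is, by computation, the root for the environment [[:: t; n; b]]. *)
by rewrite (Hp [:: t; n; b]) -wf_node_universal.
Qed.

Definition computed_by (A : cantor) (g : nat) (Y : cantor) : Prop :=
  forall n b, Y n = b :> nat <-> exists k, wf_node (event g (segment A k) n b).

(** Forbidding pairs of bits expresses implications between bits, such as upward closure; repeating
    a bit forbids a single value. *)
Definition avoids (R : nat -> nat -> nat -> nat -> Prop) (X : cantor) : Prop :=
  forall n b n' b', R n b n' b' -> X n = b :> nat -> X n' = b' :> nat -> False.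

Lemma avoids_coce_closed A R :
  oracle_ce A (fun e => R (nth 0 e 0) (nth 0 e 1) (nth 0 e 2) (nth 0 e 3)) ->
  higher_coce_closed A [set X | avoids R X].
Proof.
case=> W [HW up E].
pose V e := exists n b n' b', W [:: nth 0 e 0; n; b; n'; b'] /\
  has_bit (nth 0 e 1) n b /\ has_bit (nth 0 e 1) n' b'.
have [p Hp] : pi11 V.
  have HWs t n b n' b' : term_fun t -> term_fun n -> term_fun b ->
    term_fun n' -> term_fun b' ->
      pi11 (fun e => W [:: t e; n e; b e; n' e; b' e]).
    move=> Ht Hn Hb Hn' Hb'; apply: pi11_subst => // -[|[|[|[|[|i]]]]] //=.
    (* Entries beyond the end of the list have the default value 0. *)
    by apply: (@term_fun_const (nth 0 [::] i)).
  rewrite /V; solve_pi11; apply: HWs; solve_term.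
exists [set ts | V [:: code ts.1; code ts.2]].
  by exists p => tau sigma; exact: (Hp [:: code tau; code sigma]).
apply/seteqP; split=> X /=.
  move=> /existsNP[n /existsNP[b /existsNP[n' /existsNP[b' H]]]].
  have [r [Xn Xn']] : R n b n' b' /\ X n = b :> nat /\ X n' = b' :> nat.
    by apply: contrapT => K; apply: H => r Xn Xn'; apply: K.
  have /(E [:: n; b; n'; b'])[k w] := r.
  exists (mkseq X (maxn n n').+1); first by exists (maxn n n').+1.
  exists (mkseq A k); first by exists k.
  exists n, b, n', b'; split; first exact: w.
  by split; apply/(has_bit_segment X (maxn n n').+1); split=> //; lia.
case=> _ [m ->] [_ [k ->] [n [b [n' [b' /= [w [h h']]]]]]] H.
have [_ Xn] := (has_bit_segment X m n b).1 h.
have [_ Xn'] := (has_bit_segment X m n' b').1 h'.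
by apply: (H n b n' b') => //; apply/(E [:: n; b; n'; b']); exists k.
Qed.

Lemma higher_computable_computed_by A Y :
  higher_computable A Y -> exists g, computed_by A g Y.
Proof.
case=> Phi [p Hp] [_ total].
pose W t n b := exists s, (forall X, holds X [:: t; s] p) /\ has_bit s n b.
have [g Hg] : exists g, forall t n b, W t n b <-> wf_node (event g t n b).
  apply: event_universal.
  have HP : pi11 (fun e => forall X, holds X e p) by exists p.
  apply: (@pi11_exists (fun s e => (forall X, holds X [:: nth 0 e 0; s] p) /\
    has_bit s (nth 0 e 1) (nth 0 e 2))).
  apply: pi11_and; last first.
    by apply: pi11_arith; apply: arith_has_bit; solve_term.
  apply: (@pi11_subst _ (fun e => [:: nth 0 (behead e) 0; head 0 e]) HP).
  case=> [|[|i]] /=; [solve_term|solve_term|].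
  exact: (@term_fun_const (nth 0 [::] i)).
exists g => n b; split=> [Yb|[k /Hg[s [H hb]]]].
  have [s [_ [k ->] Ps] on] := (total n (Y n)).2 erefl.
  exists k; apply/Hg; exists (code s); split; first exact/Hp.
  by apply/has_bit_code; exists (Y n).
have [s' Es] := code_surj s; rewrite -Es in H hb.
have [b' on Eb] := (has_bit_code _ _ _).1 hb.
suff -> : Y n = b' by [].
apply/(total n b'); exists s' => //; exists (mkseq A k); first by exists k.
exact/Hp.
Qed.

Lemma self_PA_avoids A R : higher_self_PA A ->
  oracle_ce A (fun e => R (nth 0 e 0) (nth 0 e 1) (nth 0 e 2) (nth 0 e 3)) ->
  (exists X, avoids R X) -> exists Y g, avoids R Y /\ computed_by A g Y.
Proof.
move=> PA /avoids_coce_closed cl ex.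
have [Y PY /higher_computable_computed_by[g cg]] := PA _ cl ex.
by exists Y, g.
Qed.

(* V n m increases with m, so at most one value b can be the only element of
   V n m for some m. *)
Lemma diagonal_exists (V : nat -> nat -> nat -> Prop)
    (Rem : nat -> nat -> Prop) :
  (forall n m m' b, m <= m' -> V n m b -> V n m' b) ->
  (forall n b, Rem n b -> exists m b', b + b' = 1 /\ V n m b /\ ~ V n m b') ->
  exists X : cantor, forall n b, Rem n b -> X n <> b :> nat.
Proof.
move=> up H; exists (fun n => `[<Rem n 0>]) => n b.
case: asboolP => [r0|nr0] r /= Eb; last by apply: nr0; rewrite Eb.
rewrite -Eb in r; have [m [b' [E [v nv]]]] := H _ _ r.
have E1 : b' = 0 by lia.
have [m0 [b0 [E0 [v0 nv0]]]] := H _ _ r0.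
have E2 : b0 = 1 by lia.
rewrite {}E1 {}E2 in nv nv0.
(* If both values had been alone, at times m and m0, then both would be present at the later of
   these times. *)
have [le|le] := leqP m m0; first by apply: nv0; apply: up le v.
by apply: nv; apply: up (ltnW le) v0.
Qed.

Lemma oracle_ce_computed A g Y f h : computed_by A g Y -> term_fun f ->
  term_fun h ->
  oracle_ce A (fun e => Y (f e) = h e :> nat).
Proof.
move=> cY Hf Hh.
have : oracle_ce A (fun e =>
  exists k, wf_node (event g (segment A k) (f e) (h e))).
  apply: (@oracle_ce_exists _ (fun k e =>
    wf_node (event g (segment A k) (f e) (h e)))).
  apply: (@oracle_ce_subst_segment A (head 0) (fun t e =>
    wf_node (event g t (f (behead e)) (h (behead e)))));
      first exact: term_fun_head.
  apply: oracle_ce_pi11; apply: pi11_wf_node; apply: term_fun_event; solve_term.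
by case=> W [HW up E]; exists W; split=> // e; rewrite -E.
Qed.

Lemma oracle_ce_event A g k n b (Q : nat -> seq nat -> Prop) :
  term_fun g -> term_fun k -> term_fun n -> term_fun b ->
    oracle_ce A (fun e => Q (head 0 e) (behead e)) ->
  oracle_ce A (fun e => Q (event (g e) (segment A (k e)) (n e) (b e)) e).
Proof.
move=> Hg Hk Hn Hb HQ.
have : oracle_ce A (fun e =>
  exists z, z = event (g e) (segment A (k e)) (n e) (b e) /\ Q z e).
  apply: (@oracle_ce_exists _ (fun z e =>
    z = event (g e) (segment A (k e)) (n e) (b e) /\ Q z e)).
  apply: oracle_ce_and => //.
  apply: (@oracle_ce_subst_segment A (fun e => k (behead e)) (fun t e =>
    head 0 e =
    event (g (behead e)) t (n (behead e)) (b (behead e)))); first by solve_term.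
  by apply: oracle_ce_pi11; apply: pi11_arith; apply: arith_eq;
    [solve_term|apply: term_fun_event; solve_term].
case=> W [HW up E]; exists W; split=> // e; rewrite -E.
by split=> [q|[z [-> //]]]; exists (event (g e) (segment A (k e)) (n e) (b e)).
Qed.

Ltac solve_ce := cbv beta; lazymatch goal with
  | |- oracle_ce ?A (fun e =>
    wf_node (event (@?g e) (segment ?A (@?k e)) (@?n e) (@?b e))) =>
      apply (@oracle_ce_event A g k n b (fun z _ => wf_node z));
        [solve_term | solve_term | solve_term | solve_term | solve_ce]
  | |- oracle_ce ?A (fun e =>
         stage_le (event (@?g e) (segment ?A (@?k e)) (@?n e) (@?b e)) (@?a e)) =>
      apply (@oracle_ce_event A g k n b (fun z e => stage_le z (a e)));
      [solve_term | solve_term | solve_term | solve_term | solve_ce]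
  | |- oracle_ce ?A (fun e =>
         stage_lt (@?a e) (event (@?g e) (segment ?A (@?k e)) (@?n e) (@?b e))) =>
      apply (@oracle_ce_event A g k n b (fun z e => stage_lt (a e) z));
      [solve_term | solve_term | solve_term | solve_term | solve_ce]
  | |- oracle_ce ?A (fun e => nat_of_bool (?C (npair (@?m e)
         (event (@?g e) (segment ?A (@?k e)) (@?n e) (@?b e)))) = @?v e) =>
      apply (@oracle_ce_event A g k n b (fun z e =>
        C (npair (m e) z) = v e :> nat));
      [solve_term | solve_term | solve_term | solve_term | solve_ce]
  | H : computed_by ?A _ ?C |- oracle_ce ?A (fun e =>
    nat_of_bool (?C (@?f e)) = @?v e) =>
      apply (@oracle_ce_computed A _ C f v H); solve_term
  | |- oracle_ce ?A (fun e => @?P e /\ @?Q e) =>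
      apply (@oracle_ce_and A P Q); solve_ce
  | |- oracle_ce ?A (fun e => @?P e \/ @?Q e) =>
      apply (@oracle_ce_or A P Q); solve_ce
  | |- oracle_ce ?A (fun e => exists n, @?Q n e) =>
      apply (@oracle_ce_exists A Q); solve_ce
  | |- oracle_ce ?A (fun e => forall y, is_true (y <= @?f e) -> @?Q y e) =>
      apply (@oracle_ce_ball A f Q); [solve_term | solve_ce]
  | |- _ => apply oracle_ce_pi11; solve_pi11
  end.

(** * The slow point, the clock and the final diagonalization *)

Lemma self_PA_diagonal A (V Rem : nat -> nat -> nat -> Prop) :
  higher_self_PA A ->
  oracle_ce A (fun e => exists m, Rem (nth 0 e 0) m (nth 0 e 1)) ->
  (forall n m m' b, m <= m' -> V n m b -> V n m' b) ->
  (forall n m b, Rem n m b -> exists b', b + b' = 1 /\ V n m b /\ ~ V n m b') ->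
  exists Y g, computed_by A g Y /\ forall n m b, Rem n m b -> Y n <> b :> nat.
Proof.
move=> PA RemP up Rem_V.
have [X HX] : exists X : cantor,
    forall n b, (exists m, Rem n m b) -> X n <> b :> nat.
  by apply: (diagonal_exists up) => n b [m /Rem_V]; exists m.
pose R n b n' b' := (exists m, Rem n m b) /\ n' = n /\ b' = b.
have [||Y [g [avY cY]]] := @self_PA_avoids A R PA.
- apply: oracle_ce_and; first exact: RemP.
  by apply: oracle_ce_pi11; solve_pi11.
- exists X => n b _ _ [r [-> ->]] Xn _; exact: HX Xn.
exists Y, g; split=> // n m b r Yn.
by apply: (avY n b n b) => //; split=> //; exists m.
Qed.

(** [Rem] is a positive form of the statement that b is the only value in [V]: for accessible a, not
    being enumerated by stage a is expressed by [stage_lt], and it is required of the finitely many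
    uses up to m only. *)
Lemma self_PA_slow_point A : higher_self_PA A ->
  exists Y g, computed_by A g Y /\ forall a, wf_node a ->
    forall k b, ~ stage_le (event g (segment A k) (npair a g) b) a.
Proof.
move=> PA.
pose V n m b := exists a g k, n = npair a g /\ k <= m /\
  stage_le (event g (segment A k) n b) a.
pose Rem n m b := exists b' a g, b + b' = 1 /\ n = npair a g /\ wf_node a /\
  (exists k, k <= m /\ stage_le (event g (segment A k) n b) a) /\
  (forall k, k <= m -> stage_lt a (event g (segment A k) n b')).
have [||| Y [g [cY avY]]] := @self_PA_diagonal A V Rem PA.
- by rewrite /Rem; solve_ce.
- move=> n m m' b le [a [g [k [E [km st]]]]].
  by exists a, g, k; split=> //; split=> //; apply: leq_trans le.
- move=> n m b [b' [a [g [Eb [En [acc [[k [km st]] lts]]]]]]].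
  exists b'; split=> //; split; first by exists a, g, k.
  case=> a0 [g0 [k0 []]]; rewrite {1}En => /npair_inj[<- <-] [km0].
  exact/stage_lt_leF/lts.
exists Y, g; split=> // a acc k b st.
have Yb : Y (npair a g) = b :> nat.
  by apply/cY; exists k; apply: stage_le_wf st.
have bE : b + (1 - b) = 1 by rewrite -Yb; case: (Y _).
apply: (avY _ k b _ Yb); exists (1 - b), a, g; do 3![split=> //].
split=> [|k' le]; first by exists k.
(* The g-th functional never enumerates the wrong value on A, so the event for that value is
   inaccessible and comes after stage a. *)
apply: stage_ltNge => // /stage_le_wf w.
have : Y (npair a g) = 1 - b :> nat by apply/cY; exists k'.
by rewrite Yb; lia.
Qed.

(* C m is the indicator of the nodes that appear after time m. *)
Lemma self_PA_clock A : higher_self_PA A ->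
  exists C g, [/\ computed_by A g C,
    forall a, wf_node a -> exists m, C (npair m a) = 0 :> nat,
    forall m, exists2 c, wf_node c & C (npair m c) = 1 :> nat &
    forall m a b, stage_le a b -> C (npair m a) = 1 :> nat ->
      C (npair m b) = 1 :> nat].
Proof.
move=> PA; have [Y [g [cY slow]]] := self_PA_slow_point PA.
(* The clauses say in turn that C(m) contains every stage by which Y(m) is enumerated, that C(m) is
   upward closed, and that it omits a when m = <a, g>. *)
pose R n b n' b' :=
  (exists m a k c, n = npair m a /\ n' = n /\ b = 0 /\ b' = 0 /\
     stage_le (event g (segment A k) m c) a) \/
  (exists m a a', n = npair m a /\ n' = npair m a' /\ b = 1 /\ b' = 0 /\
     stage_le a a') \/
  (exists a, n = npair (npair a g) a /\ n' = n /\ b = 1 /\ b' = 1 /\ wf_node a).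
have [||C [g' [avC cC]]] := @self_PA_avoids A R PA.
- by rewrite /R; solve_ce.
(* The smallest candidate satisfies all the constraints; the third one holds because Y is slow. *)
- pose X z := `[<exists m a k c, z = npair m a /\
  stage_le (event g (segment A k) m c) a>].
  exists X => n b n' b'; rewrite /R.
  case=> [[m [a [k [c [-> [-> [-> [-> st]]]]]]]]|[|]].
  + have -> : X (npair m a) by apply/asboolP; exists m, a, k, c.
    by [].
  + case=> m [a [a' [-> [-> [-> [-> le]]]]]].
    rewrite /X; case: asboolP => // -[m0 [a0 [k [c [/npair_inj[<- <-] st]]]]] _.
    case: asboolP => // N _; apply: N; exists m, a', k, c; split=> //.
    exact: stage_le_trans le.
  + case=> a [-> [-> [-> [-> acc]]]].
    rewrite /X; case: asboolP => // -[m0 [a0 [k [c [/npair_inj[<- <-] st]]]]].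
    by case: (slow _ acc _ _ st).
have C01 z : C z = 0 :> nat \/ C z = 1 :> nat by case: (C z); [right|left].
exists C, g'; split=> //.
- move=> a acc; exists (npair a g).
  case: (C01 (npair (npair a g) a)) => // C1.
  by case: (avC _ _ _ _ (or_intror (or_intror _)) C1 C1); exists a.
- move=> m; have /cY[k acc] : Y m = Y m :> nat by [].
  (* The event that enumerates Y(m) is itself a stage by which Y(m) is enumerated. *)
  exists (event g (segment A k) m (Y m)) => //; set c := event _ _ _ _.
  case: (C01 (npair m c)) => // C0.
  case: (avC _ _ _ _ (or_introl _) C0 C0); exists m, c, k, (Y m).
  by do 4![split=> //]; apply: stage_le_refl.
- move=> m a a' le C1; case: (C01 (npair m a')) => // C0.
  by case: (avC _ _ _ _ (or_intror (or_introl _)) C1 C0); exists m, a, a'.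
Qed.

(** The sets C(m) need not decrease with m, so [V] allows any time m' up to m in order to be
    increasing. [Rem] certifies the absence of the other value b' through events that the clock
    places late, directly or above an accessible late stage. *)
Lemma no_higher_self_PA A : ~ higher_self_PA A.
Proof.
move=> PA; have [C [g' [cC early late mono]]] := self_PA_clock PA.
pose V n m b := exists m' k, m' <= m /\ k <= m /\
  wf_node (event n (segment A k) n b) /\
    C (npair m' (event n (segment A k) n b)) = 0 :> nat.
pose Rem n m b := exists b', b + b' = 1 /\
  (exists m', m' <= m /\ exists k, k <= m /\
    wf_node (event n (segment A k) n b) /\
    C (npair m' (event n (segment A k) n b)) = 0 :> nat) /\
  (forall m', m' <= m -> forall k, k <= m ->
     C (npair m' (event n (segment A k) n b')) = 1 :> nat \/
     exists c, wf_node c /\ C (npair m' c) = 1 :> nat /\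
       stage_lt c (event n (segment A k) n b')).
have [||| Y [g [cY avY]]] := @self_PA_diagonal A V Rem PA.
- by rewrite /Rem; solve_ce.
- move=> n m m1 b le [m' [k [le1 [le2 H]]]].
  by exists m', k; split; [|split=> //]; apply: leq_trans le.
- move=> n m b [b' [Eb [[m' [le [k [le' H]]]] N]]].
  exists b'; split=> //; split; first by exists m', k.
  case=> m0 [k0 [lem [lek [acc C0]]]].
  have [C1|[c [_ [C1 /stage_ltW lt]]]] := N _ lem _ lek;
    first by rewrite C0 in C1.
  by have := mono _ _ _ lt C1; rewrite C0.
have /cY[k acc] : Y g = Y g :> nat by [].
have [m C0] := early _ acc.
apply: (avY g (maxn m k) (Y g)) => //.
exists (1 - Y g); split; first by case: (Y g).
split; first by exists m; split; [exact: leq_maxl|exists k; split;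
  [exact: leq_maxr|]].
(* The stage c has not elapsed at time m', and the event for the wrong value is inaccessible, hence
   strictly above c. *)
move=> m' _ k' _; right; have [c accc C1] := late m'.
exists c; split=> //; split=> //; apply: stage_ltNge => // /stage_le_wf w.
have : Y g = 1 - Y g :> nat by apply/cY; exists k'.
by case: (Y g).
Qed.

Theorem theorem3p3 :
  (~ exists A : cantor, higher_self_PA A) /\
  (forall A : cantor, exists P : set cantor,
     [/\ higher_coce_closed A P, P !=set0 &
         forall Y : cantor, P Y -> ~ higher_computable A Y]).
Proof.
split=> [[A]|A]; first exact: no_higher_self_PA.
apply: contrapT => /forallNP H; apply: (@no_higher_self_PA A) => P clP ne.
apply: contrapT => N; apply: (H P); split=> // Y PY cY.
by apply: N; exists Y.
Qed.
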